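(* Let $L/k$ be a finite field extension of degree $m$, let $n\geq 1$ be an integer such that $n\leq m$, let $C$ be an $L$-linear subspace of $L^n$, and let $r$ be an integer with $1\leq r\leq \dim_L C$. Then $$d_{R,r}(C)=\mathcal{M}_r(C)=OS_r(C)=D_r(C).$$
   Context: Let $L/k$ be a finite field extension of degree $m$ and fix a $k$-basis $\alpha_1,\ldots,\alpha_m$ of $L$. For $\mathbf{c}=(c_1,\ldots,c_n)\in L^n$ write $c_j=\sum_{i=1}^m c_{ij}\alpha_i$ with $c_{ij}\in k$, and let $M(\mathbf{c})=(c_{ij})$, an $m\times n$ matrix over $k$. The rank support $\mathrm{Rsupp}(\mathbf{c})$ is the $k$-subspace of $k^n$ spanned by the rows of $M(\mathbf{c})$ (independent of the choice of basis), and the rank weight is $\mathrm{wt}_R(\mathbf{c})=\dim_k\mathrm{Rsupp}(\mathbf{c})$. For an $L$-linear subspace $D\subset L^n$, $\mathrm{Rsupp}(D)$ is the $k$-subspace of $k^n$ spanned by all $\mathrm{Rsupp}(\mathbf{d})$, $\mathbf{d}\in D$, and $\mathrm{wt}_R(D)=\dim_k\mathrm{Rsupp}(D)$. Put $\mathrm{maxwt}_R(D)=\max_{\mathbf{d}\in D}\mathrm{wt}_R(\mathbf{d})$. An $L$-linear subspace of $L^n$ is extended from $k^n$ if it is spanned over $L$ by vectors in $k^n$. For an $L$-linear subspace $D\subset L^n$, $D^*$ denotes the intersection of all $L$-linear subspaces of $L^n$ that are extended from $k^n$ and contain $D$; it is the smallest $L$-linear subspace extended from $k^n$ containing $D$.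 For an $L$-linear subspace $C\subset L^n$ and $1\leq r\leq\dim_L C$, define (where $D$ ranges over $L$-linear subspaces of $C$, $V$ over $L$-linear subspaces of $L^n$, and $\dim=\dim_L$): - $d_{R,r}(C)=\min\{\mathrm{wt}_R(D) : D\subset C,\ \dim D=r\}$; - $\mathcal{M}_r(C)=\min\{\dim V : V\subset L^n,\ V=V^*,\ \dim(C\cap V)\geq r\}$; - $OS_r(C)=\min\{\mathrm{maxwt}_R(D) : D\subset C,\ \dim D=r\}$; - $D_r(C)=\min\{\mathrm{maxwt}_R(D^* ) : D\subset C,\ \dim D=r\}$. *)

(* Defs.v *)
From HB Require Import structures.
From mathcomp Require Import all_boot all_order all_algebra all_field.
From mathcomp Require Import boolp classical_sets.

Set Implicit Arguments.
Unset Strict Implicit.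
Unset Printing Implicit Defensive.

Import GRing.Theory.
Local Open Scope classical_set_scope.
Local Open Scope ring_scope.

(* Extrema of sets of naturals; the default 0 is only reached when the
   extremum does not exist, see [natminP] and [natmaxP]. *)
Definition natmin (S : set nat) : nat :=
  xget 0%N [set x | S x /\ forall y, S y -> (x <= y)%N].

Definition natmax (S : set nat) : nat :=
  xget 0%N [set x | S x /\ forall y, S y -> (y <= x)%N].

Lemma natminP (S : set nat) : (exists x, S x) ->
  S (natmin S) /\ forall y, S y -> (natmin S <= y)%N.
Proof.
move=> [x Sx]; rewrite /natmin; case: xgetP => [y _ //|H]; exfalso.
have ex : exists x, `[< S x >] by exists x; apply/asboolP.
case: (ex_minnP ex) => z /asboolP Sz zmin.
apply: (H z); split=> // y Sy; apply: zmin; exact/asboolP.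
Qed.

Lemma natmaxP (S : set nat) (b : nat) :
  (exists x, S x) -> (forall x, S x -> (x <= b)%N) ->
  S (natmax S) /\ forall y, S y -> (y <= natmax S)%N.
Proof.
move=> [x Sx] leb; rewrite /natmax; case: xgetP => [y _ //|H]; exfalso.
have ex : exists x, `[< S x >] by exists x; apply/asboolP.
have bd y : `[< S y >] -> (y <= b)%N by move/asboolP/leb.
case: (ex_maxnP ex bd) => z /asboolP Sz zmax.
apply: (H z); split=> // y Sy; apply: zmax; exact/asboolP.
Qed.

Section Subspaces.
Variables (K : fieldType) (V : vectType K).

(* The [{vspace V}] with underlying set [P], for [P] a linear subspace. *)
Definition vspace_of (P : set V) : {vspace V} :=
  xget 0%VS [set U : {vspace V} | forall v, (v \in U) <-> P v].

Lemma vspace_ofP (P : set V) : P 0 ->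
  (forall (a : K) u v, P u -> P v -> P (a *: u + v)) ->
  forall v, (v \in vspace_of P) <-> P v.
Proof.
move=> P0 Plin; rewrite /vspace_of; case: xgetP => [U _ //|H]; exfalso.
pose S : set nat :=
  [set d | exists U : {vspace V}, \dim U = d /\ forall v, v \in U -> P v].
have exS : exists d, S d.
  by exists 0%N, 0%VS; split; [rewrite dimv0|move=> v; rewrite memv0 => /eqP ->].
have bdS d : S d -> (d <= \dim {:V})%N.
  by move=> [U [<- _]]; apply: dimvS; apply: subvf.
have [[U [dimU UP]] Umax] := natmaxP exS bdS.
apply: (H U) => v; split=> [/UP //|Pv].
have /Umax : S (\dim (U + <[v]>)%VS).
  exists (U + <[v]>)%VS; split=> // w /memv_addP [u uU [x /vlineP [a ->] ->]].
  by rewrite addrC; apply: Plin => //; apply: UP.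
rewrite -dimU => le.
have /eqP -> : U == (U + <[v]>)%VS by rewrite eqEdim addvSl.
by rewrite memvE addvSr.
Qed.

(* Linear span of an arbitrary set of vectors. *)
Definition spanset (S : set V) : {vspace V} :=
  vspace_of [set v : V | exists s : seq V,
    (forall x, x \in s -> S x) /\ v \in <<s>>%VS].

(* Intersection of an arbitrary family of subspaces. *)
Definition capset (F : set {vspace V}) : {vspace V} :=
  vspace_of [set v : V | forall U, F U -> v \in U].

Lemma mem_spanset (S : set V) v :
  v \in spanset S <->
  exists s : seq V, (forall x, x \in s -> S x) /\ v \in <<s>>%VS.
Proof.
apply: (vspace_ofP (P := [set v : V | exists s : seq V,
    (forall x, x \in s -> S x) /\ v \in <<s>>%VS])).
  by exists [::]; split; rewrite ?mem0v.
move=> a u w [s [sS us]] [t [tS wt]]; exists (s ++ t); split.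
  by move=> x; rewrite mem_cat => /orP [/sS|/tS].
by rewrite span_cat memv_add // memvZ.
Qed.

Lemma mem_capset (F : set {vspace V}) v :
  v \in capset F <-> forall U, F U -> v \in U.
Proof.
apply: (vspace_ofP (P := [set v : V | forall U, F U -> v \in U])).
  by move=> U _; apply: mem0v.
by move=> a u w Fu Fw U FU; rewrite memvD ?memvZ ?Fu ?Fw.
Qed.

End Subspaces.

Section RankWeights.
Variables (k : fieldType) (L : fieldExtType k) (m n : nat).
Variable alpha : m.-tuple L.

Definition coordmx (c : 'rV[L]_n) : 'M[k]_(m, n) :=
  \matrix_(i, j) coord alpha i (c 0 j).

Definition Rsupp (c : 'rV[L]_n) : {vspace 'rV[k]_n} :=
  <<[seq row i (coordmx c) | i : 'I_m]>>%VS.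

Definition wtR (c : 'rV[L]_n) : nat := \dim (Rsupp c).

Definition RsuppD (D : {vspace 'rV[L]_n}) : {vspace 'rV[k]_n} :=
  spanset [set v : 'rV[k]_n | exists2 d, d \in D & v \in Rsupp d].

Definition wtRD (D : {vspace 'rV[L]_n}) : nat := \dim (RsuppD D).

Definition maxwtR (D : {vspace 'rV[L]_n}) : nat :=
  natmax [set wtR d | d in [set d : 'rV[L]_n | d \in D]].

Definition extended (V : {vspace 'rV[L]_n}) : Prop :=
  exists s : seq 'rV[k]_n, V = <<[seq map_mx (in_alg L) v | v <- s]>>%VS.

Definition star (D : {vspace 'rV[L]_n}) : {vspace 'rV[L]_n} :=
  capset [set V : {vspace 'rV[L]_n} | extended V /\ (D <= V)%VS].

Definition dR (r : nat) (C : {vspace 'rV[L]_n}) : nat :=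
  natmin [set wtRD D | D in [set D : {vspace 'rV[L]_n} | (D <= C)%VS /\ \dim D = r]].

Definition Mr (r : nat) (C : {vspace 'rV[L]_n}) : nat :=
  natmin [set \dim V | V in [set V : {vspace 'rV[L]_n} | V = star V /\ (r <= \dim (C :&: V))%N]].

Definition OS (r : nat) (C : {vspace 'rV[L]_n}) : nat :=
  natmin [set maxwtR D | D in [set D : {vspace 'rV[L]_n} | (D <= C)%VS /\ \dim D = r]].

Definition Dr (r : nat) (C : {vspace 'rV[L]_n}) : nat :=
  natmin [set maxwtR (star D) | D in [set D : {vspace 'rV[L]_n} | (D <= C)%VS /\ \dim D = r]].

Lemma maxwtRP (D : {vspace 'rV[L]_n}) :
  (exists2 d, d \in D & wtR d = maxwtR D) /\
  (forall d, d \in D -> (wtR d <= maxwtR D)%N).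
Proof.
have ex : exists x, [set wtR d | d in [set d : 'rV[L]_n | d \in D]] x.
  by exists (wtR 0), 0 => //; apply: mem0v.
have bd x : [set wtR d | d in [set d : 'rV[L]_n | d \in D]] x ->
    (x <= \dim {:'rV[k]_n})%N.
  by move=> [d _ <-]; apply: dimvS; apply: subvf.
have [[d dD de] H] := natmaxP ex bd; split; first by exists d.
by move=> e eD; apply: H; exists e.
Qed.

Lemma exists_subspace (r : nat) (C : {vspace 'rV[L]_n}) : (r <= \dim C)%N ->
  exists D : {vspace 'rV[L]_n}, (D <= C)%VS /\ \dim D = r.
Proof.
move=> rC; have fC := basis_free (vbasisP C).
exists <<take r (vbasis C)>>%VS; split.
  by apply/span_subvP => x /mem_take; apply: vbasis_mem.
move: fC; rewrite -{1}(cat_take_drop r (vbasis C)) => /catl_free/eqP ->.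
by rewrite size_takel // size_tuple.
Qed.

Lemma star_fullv : fullv = star fullv.
Proof.
apply/eqP; rewrite eqEsubv subvf andbT; apply/subvP => v _.
apply/(mem_capset [set V : {vspace 'rV[L]_n} | extended V /\ (fullv <= V)%VS]) => U [_].
by move/subvP; apply; apply: memvf.
Qed.

Lemma Mr_nonempty (r : nat) (C : {vspace 'rV[L]_n}) : (r <= \dim C)%N ->
  exists V : {vspace 'rV[L]_n}, V = star V /\ (r <= \dim (C :&: V))%N.
Proof. by exists fullv; split; [exact: star_fullv|rewrite capvf]. Qed.

End RankWeights.

(* Main.v *)
(* D^* is the extension to L of Rsupp(D), so dim D^* = wt_R(D); this gives
   d_{R,r} = M_r.  The other two equalities hold subspace by subspace, because
   maxwt_R(D) = wt_R(D) when n <= m: if Rsupp(v) is not contained in Rsupp(d),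
   then wt_R(d + t v) > wt_R(d) for some t in L.  When k is finite, count: each
   of fewer than |L| nonzero vectors excludes at most one t.  When k is infinite,
   take t on a suitable line k s, where a polynomial minor is not identically 0. *)

Require Import Defs.
From mathcomp Require Import all_boot all_order all_algebra all_field.
From HB Require Import structures.
From mathcomp Require Import boolp classical_sets.
Local Open Scope ring_scope.
Import GRing.Theory.

(** * Finite fields by counting, infinite fields by polynomials *)

(** If no list exhausts [k], there are duplicate-free lists of every length, and a nonzero [p]
    cannot have [size p] distinct roots. *)
Lemma finite_or_nonvanishing (k : fieldType) :
  (exists s : seq k, forall x, x \in s) \/
  (forall p : {poly k}, p != 0 -> exists x, p.[x] != 0).
Proof.
case: (pselect (exists s : seq k, forall x, x \in s)) => [|infk]; [by left|right].
move=> p p0; apply: contrapT => np.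
have long N : exists2 s : seq k, uniq s & size s = N.
  elim: N => [|N [s us <-]]; first by exists [::].
  case: (pselect (exists x, x \notin s)) => [[x xs]|ns].
    by exists (x :: s) => //=; rewrite xs.
  case: infk; exists s => x; apply: contrapT => xs; apply: ns.
  by exists x; apply/negP.
have [s us ss] := long (size p).
have: (size s < size p)%N.
  apply: max_poly_roots => //; apply/allP => x _; apply: contrapT => nx.
  by apply: np; exists x; apply/negP.
by rewrite ss ltnn.
Qed.

(** There are only |k|^p - 1 nonzero arguments, fewer than the |k|^m possible values. *)
Lemma not_onto_finField (k : finFieldType) (p m : nat)
    (g : 'rV[k]_p -> 'rV[k]_m) : (p <= m)%N ->
  exists y, forall c, c != 0 -> g c <> y.
Proof.
move=> pm; apply: contrapT => onto.
have ex y : exists c, (c != 0) && (g c == y).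
  apply: contrapT => ny; apply: onto; exists y => c c0 gc.
  by apply: ny; exists c; rewrite c0 gc eqxx.
pose h y := xchoose (ex y).
have hP y : h y != 0 /\ g (h y) = y by have /andP[? /eqP] := xchooseP (ex y).
have injh : injective h by move=> y z e; rewrite -(hP y).2 e (hP z).2.
have : (#|[set: 'rV[k]_m]%SET| <= #|[set~ (0%R : 'rV[k]_p)]%SET|)%N.
  rewrite -(card_imset _ injh); apply: subset_leq_card.
  by apply/fintype.subsetP => _ /imsetP [y _ ->]; rewrite !inE (hP y).1.
rewrite cardsT cardsC1 !card_mx !mul1n.
have kp : (0 < #|k| ^ p)%N by rewrite expn_gt0 (cardD1 0) inE.
rewrite -ltnS prednK // ltnNge leq_exp2l ?pm //.
by apply: finNzRing_gt1.
Qed.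

Lemma not_onto_finite (k : fieldType) (s : seq k) (p m : nat)
    (g : 'rV[k]_p -> 'rV[k]_m) : (forall x, x \in s) -> (p <= m)%N ->
  exists y, forall c, c != 0 -> g c <> y.
Proof.
move=> ks pm.
(* The list [s] makes the same field a [finFieldType]: [index] into [s] gives countability and
   [undup s] the enumeration. *)
have fin : Finite.axiom (undup s).
  by move=> x; rewrite count_uniq_mem ?undup_uniq // mem_undup ks.
have nthK : pcancel (index^~ s) (fun i => Some (nth 0 s i)).
  by move=> x; rewrite nth_index.
pose kc : countType := HB.pack (GRing.Field.sort k) (PCanIsCountable nthK).
pose kf : finFieldType := HB.pack (GRing.Field.sort k) kc (isFinite.Build kc fin).
exact: (@not_onto_finField kf).
Qed.

(** The determinant is a polynomial in x with value 1 at 0, so it is not the zero polynomial; the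
    extra factor 'X forces x to be nonzero. *)
Lemma det_add_scale_nonzero (k : fieldType) (p : nat) (E : 'M[k]_p) :
  (forall q : {poly k}, q != 0 -> exists x, q.[x] != 0) ->
  exists2 x : k, x != 0 & 1%:M + x *: E \in unitmx.
Proof.
move=> nonvan.
pose P : {poly k} := \det (1%:M + 'X *: map_mx polyC E).
have PE x : P.[x] = \det (1%:M + x *: E).
  rewrite -[LHS]/(horner_eval x P) -det_map_mx; congr (\det _).
  apply/matrixP => i j; rewrite !mxE /horner_eval.
  by rewrite /= horner_evalE !hornerE hornerMn hornerC.
have P0 : P != 0.
  apply/eqP => P0; have := PE 0; rewrite P0 horner0 scale0r addr0 det1.
  by move/eqP; rewrite eq_sym oner_eq0.
have [|x] := nonvan ('X * P); first by rewrite mulf_neq0 ?polyX_eq0.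
rewrite hornerM hornerX mulf_eq0 negb_or PE => /andP [x0 dx].
by exists x => //; rewrite unitmxE unitfE.
Qed.

(** * Coordinates of L over k *)

Definition coordcol {k : fieldType} {L : fieldExtType k} {m : nat}
  (alpha : m.-tuple L) (l : L) : 'cV[k]_m := \col_i coord alpha i l.

Definition colcomb {k : fieldType} {L : fieldExtType k} {m : nat}
  (alpha : m.-tuple L) (y : 'cV[k]_m) : L := \sum_i y i 0 *: alpha`_i.

(** The matrix, in the basis [alpha], of multiplication by [t] as a k-linear map of L. *)
Definition mulcoordmx {k : fieldType} {L : fieldExtType k} {m : nat}
  (alpha : m.-tuple L) (t : L) : 'M[k]_m :=
  \matrix_(i, j) coord alpha i (t * alpha`_j).

Section Coordinates.
Context {k : fieldType} {L : fieldExtType k} {m : nat} (alpha : m.-tuple L).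
Context (basis_alpha : basis_of {:L} alpha).

Lemma coordcolK l : colcomb alpha (coordcol alpha l) = l.
Proof.
rewrite [RHS](coord_basis basis_alpha (memvf l)).
by apply: eq_bigr => i _; rewrite mxE.
Qed.

Lemma colcombK y : coordcol alpha (colcomb alpha y) = y.
Proof.
apply/colP => i; rewrite mxE coord_sum_free //.
exact: basis_free basis_alpha.
Qed.

Lemma colcombD y z : colcomb alpha (y + z) = colcomb alpha y + colcomb alpha z.
Proof. by rewrite -big_split; apply: eq_bigr => i _; rewrite mxE scalerDl. Qed.

Lemma colcomb0 : colcomb alpha 0 = 0.
Proof. by rewrite /colcomb big1 // => i _; rewrite mxE scale0r. Qed.

Lemma colcomb_eq0 y : (colcomb alpha y == 0) = (y == 0).
Proof.
apply/eqP/eqP => [y0|->]; last exact: colcomb0.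
by rewrite -[y]colcombK y0; apply/colP => i; rewrite !mxE linear0.
Qed.

Lemma mul_mulcoordmx t y :
  mulcoordmx alpha t *m y = coordcol alpha (t * colcomb alpha y).
Proof.
apply/colP => i; rewrite !mxE /colcomb mulr_sumr linear_sum.
by apply: eq_bigr => j _; rewrite mxE -scalerAr linearZ mulrC.
Qed.

Lemma mulcoordmxZ x t : mulcoordmx alpha (x *: t) = x *: mulcoordmx alpha t.
Proof. by apply/matrixP => i j; rewrite !mxE -scalerAl linearZ. Qed.

Lemma coordmxDZ n (c d : 'rV[L]_n) t :
  coordmx alpha (c + t *: d) =
  coordmx alpha c + mulcoordmx alpha t *m coordmx alpha d.
Proof.
apply/matrixP => i j; rewrite !mxE linearD; congr (_ + _).
rewrite {1}(coord_basis basis_alpha (memvf (d 0 j))) mulr_sumr linear_sum.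
by apply: eq_bigr => l _; rewrite !mxE -scalerAr linearZ /= mulrC.
Qed.

End Coordinates.

(** * Raising the rank by adding an L-multiple *)

Lemma inj_row_full {k : fieldType} {m p : nat} (Z : 'M[k]_(m, p)) :
  (forall c : 'cV_p, Z *m c = 0 -> c = 0) -> row_full Z.
Proof.
move=> inj; rewrite /row_full -mxrank_tr; apply: inj_row_free => v vZ.
apply: trmx_inj; rewrite trmx0; apply: inj.
by rewrite -[Z]trmxK -trmx_mul vZ trmx0.
Qed.

(** For coordinate matrices [A] of d and [B] of v, the vector [a] witnesses that Rsupp(v) is not
    inside Rsupp(d), and the new matrix is that of d + t v. Its rank is bounded below by finding
    \rank A + 1 vectors with independent images. *)
Lemma exists_rank_gt (k : fieldType) (L : fieldExtType k) (m n : nat)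
    (alpha : m.-tuple L) (A B : 'M[k]_(m, n)) (a : 'cV[k]_n) :
  basis_of {:L} alpha -> (n <= m)%N -> A *m a = 0 -> B *m a != 0 ->
  exists t, (\rank A < \rank (A + mulcoordmx alpha t *m B)%R)%N.
Proof.
move=> basis_alpha nm Aa Ba.
(* The columns of [R] are chosen so that [A] maps them to a basis of its column space. *)
have /row_freeP [R RE] := row_base_free A.
have AR : A *m R = col_base A by rewrite -[RHS]mulmx1 -RE mulmxA mulmx_base.
have cbI (c : 'cV_(\rank A)) : col_base A *m c = 0 -> c = 0.
  have /row_fullP [N NE] := col_base_full A.
  by move=> c0; rewrite -[c]mul1mx -NE -mulmxA c0 mulmx0.
have a0 : a != 0 by apply: contraNneq Ba => ->; rewrite mulmx0.
have rAn : (\rank A < n)%N.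
  rewrite ltn_neqAle rank_leq_col andbT; apply: contra a0 => /row_fullP [N NE].
  by rewrite -[a]mul1mx -NE -mulmxA Aa mulmx0.
have scol q (c2 : 'M[k]_1) (u : 'cV[k]_q) : u *m c2 = c2 0 0 *: u.
  by rewrite {1}[c2]mx11_scalar mul_mx_scalar.
have rank_ge (M : 'M[k]_(m, n)) (U : 'M_(n, \rank A + 1)) :
    row_full (M *m U) -> (\rank A < \rank M)%N.
  by move=> /eqP rMU; rewrite -[X in (X <= _)%N]addn1 -{1}rMU mxrankM_maxl.
(* Finite case: t is bad for c only if t = - A U c / B U c (columns read as
   elements of L), and c ranges
   over a space of dimension \rank A + 1 <= m. *)
have [[s ks]|nonvan] := finite_or_nonvanishing k.
  (* [A] is injective on combinations of [R] and kills [a], while [B] does not kill [a]. So if (A +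
     t B) U c = 0 with c nonzero, then B U c is nonzero and one may divide by it. *)
  pose U := row_mx R a.
  have UI (c : 'cV_(\rank A + 1)) :
      A *m (U *m c) = 0 -> B *m (U *m c) = 0 -> c = 0.
    rewrite -[c]vsubmxK; set c1 := usubmx c; set c2 := dsubmx c.
    rewrite mul_row_col !mulmxDr !mulmxA Aa AR mul0mx addr0 => /cbI ->.
    rewrite mulmx0 add0r scol => /eqP.
    rewrite scaler_eq0 (negPf Ba) orbF => /eqP c20.
    by rewrite [c2]mx11_scalar c20 raddf0 col_mx0.
  pose g (c : 'rV_(\rank A + 1)) : 'rV_m := (coordcol alpha
    (- colcomb alpha (A *m (U *m c^T)) / colcomb alpha (B *m (U *m c^T))))^T.
  have [|y yP] := not_onto_finite _ s _ _ g ks; first by rewrite addn1 (leq_trans rAn).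
  exists (colcomb alpha y^T); apply: (rank_ge _ U); apply: inj_row_full => c.
  rewrite -mulmxA mulmxDl -[_ *m B *m _]mulmxA mul_mulcoordmx // => c0.
  apply/eqP; apply: contraT => cn0.
  have BU0 : colcomb alpha (B *m (U *m c)) != 0.
    apply: contra cn0; rewrite colcomb_eq0 // => /eqP BU0; apply/eqP/UI => //.
    by move: c0; rewrite BU0 colcomb0 mulr0 -(colcomb0 alpha) colcombK // addr0.
  case: (yP c^T); first by rewrite -trmx0 (inj_eq trmx_inj).
  rewrite /g trmxK; apply: trmx_inj; rewrite trmxK.
  rewrite -[RHS](colcombK alpha basis_alpha); congr (coordcol _ _).
  apply: (mulIf BU0); rewrite divfK //; apply/esym/eqP; rewrite -addr_eq0 addrC.
  by move/(congr1 (colcomb alpha)): c0; rewrite colcombD coordcolK // colcomb0 => ->.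
(* Infinite case: choose t so that y = t B a is outside the column space of
   A.  Then (A + x t B) [R | x^-1 a] = [A R | y] + x [t B R | 0], and the right
   side has full rank at x = 0, hence also at some x != 0. *)
have [y yA] : exists y : 'cV_m, ~~ (y^T <= A^T)%MS.
  have : ~~ (1%:M <= A^T)%MS.
    apply/negP => /mxrankS; rewrite mxrank1 mxrank_tr leqNgt.
    by rewrite (leq_trans rAn).
  by case/row_subPn => i nA; exists (row i 1%:M)^T; rewrite trmxK.
pose t := colcomb alpha y / colcomb alpha (B *m a).
have ty : mulcoordmx alpha t *m B *m a = y.
  by rewrite -mulmxA mul_mulcoordmx // divfK ?colcomb_eq0 // colcombK.
have /row_fullP [N NE] : row_full (row_mx (col_base A) y).
  apply: inj_row_full => c.
  rewrite -[c]vsubmxK; set c1 := usubmx c; set c2 := dsubmx c.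
  rewrite mul_row_col scol => c0.
  have c20 : c2 0 0 = 0.
    apply/eqP; apply: contraNT yA => nz.
    have -> : y = A *m (R *m (- (c2 0 0)^-1 *: c1)).
      rewrite mulmxA AR -scalemxAr scaleNr; apply/eqP; rewrite -addr_eq0.
      by rewrite -[X in X + _](scalerK nz) -scalerDr addrC c0 scaler0.
    by rewrite trmx_mul submxMl.
  move: c0; rewrite c20 scale0r addr0 => /cbI ->.
  by rewrite [c2]mx11_scalar c20 raddf0 col_mx0.
(* [N] is a left inverse of [A R | y], so multiplying the sum above by [N] gives 1 + x E. *)
pose E := N *m row_mx (mulcoordmx alpha t *m B *m R) (0 : 'M_(m, 1)).
have [x x0 xE] := det_add_scale_nonzero _ _ E nonvan.
exists (x *: t); apply: (rank_ge _ (row_mx R (x^-1 *: a))).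
apply/row_fullP; exists (invmx (1%:M + x *: E) *m N).
rewrite -mulmxA -[RHS](mulVmx xE); congr (_ *m _).
rewrite -NE /E scalemxAr -mulmxDr; congr (_ *m _).
rewrite scale_row_mx scaler0 add_row_mx addr0 mul_mx_row mulcoordmxZ.
rewrite !mulmxDl -!scalemxAl -!scalemxAr AR Aa scaler0 add0r ty.
by rewrite scalerA mulfV // scale1r.
Qed.

(** * Row spaces, rank supports and extension of scalars *)

Lemma mem_span_rows (k : fieldType) (m n : nat) (M : 'M[k]_(m, n)) v :
  (v \in <<[seq row i M | i : 'I_m]>>%VS) = (v <= M)%MS.
Proof.
apply/idP/idP => [|/submxP [u ->]].
  move/(@coord_span _ _ _ (in_tuple _)) => ->.
  apply: summx_sub => j _; apply: scalemx_sub.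
  have /mapP [i _ ->] := mem_nth 0 (ltn_ord j).
  exact: row_sub.
rewrite mulmx_sum_row; apply: memv_suml => i _.
by apply/memvZ/memv_span/map_f; rewrite mem_enum.
Qed.

Lemma dim_span_rows (k : fieldType) (m n : nat) (M : 'M[k]_(m, n)) :
  \dim <<[seq row i M | i : 'I_m]>> = \rank M.
Proof.
have -> : <<[seq row i M | i : 'I_m]>>%VS =
    <<[seq row i (row_base M) | i : 'I_(\rank M)]>>%VS.
  by apply/vspaceP => v; rewrite !mem_span_rows eq_row_base.
pose X := [tuple row i (row_base M) | i < \rank M].
rewrite -[RHS](size_tuple X); apply/eqP; rewrite -[_ == _]/(free X).
apply/freeP => c c0 i.
suff /rowP/(_ i) : \row_i c i = 0 by rewrite !mxE.
apply: (row_free_inj (row_base_free M)); rewrite mul0mx mulmx_sum_row.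
rewrite -[RHS]c0; apply: eq_bigr => j _.
by rewrite mxE -tnth_nth tnth_mktuple.
Qed.

Section Supports.
Context {k : fieldType} {L : fieldExtType k} {m n : nat} (alpha : m.-tuple L).
Context (basis_alpha : basis_of {:L} alpha).
Local Notation ext s := <<[seq map_mx (in_alg L) v | v <- s]>>%VS.

Lemma row_coordmxE (d : 'rV[L]_n) :
  d = \sum_(i < m) alpha`_i *: map_mx (in_alg L) (row i (coordmx alpha d)).
Proof.
apply/rowP => j; rewrite summxE.
rewrite {1}(coord_basis basis_alpha (memvf (d 0 j))).
by apply: eq_bigr => i _; rewrite !mxE /= -scalerAr mulr1.
Qed.

Lemma row_coordmx_sum (I : finType) (c : I -> L) (u : I -> 'rV[k]_n) i :
  row i (coordmx alpha (\sum_j c j *: map_mx (in_alg L) (u j))) =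
  \sum_j coord alpha i (c j) *: u j.
Proof.
apply/rowP => l; rewrite !mxE !summxE linear_sum; apply: eq_bigr => j _.
by rewrite !mxE /= -scalerAr mulr1 linearZ /= mulrC.
Qed.

(** Taking [alpha]-coordinates of an L-combination of [s] gives k-combinations of [s]; conversely
    [d] is the [alpha]-combination of the rows of its coordinate matrix. *)
Lemma mem_ext (s : seq 'rV[k]_n) (d : 'rV[L]_n) :
  (d \in ext s) = (Rsupp alpha d <= <<s>>)%VS.
Proof.
pose X := map_tuple (map_mx (in_alg L)) (in_tuple s).
have XE (j : 'I_(size s)) : X`_j = map_mx (in_alg L) s`_j.
  by rewrite (nth_map 0).
apply/idP/idP => [/(@coord_span _ _ _ X)->|/subvP sd].
  apply/span_subvP => _ /mapP [i _ ->].
  rewrite (eq_bigr _ (fun j _ => congr1 _ (XE j))) row_coordmx_sum.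
  by apply: memv_suml => j _; rewrite memvZ ?memv_span ?mem_nth.
rewrite (row_coordmxE d); apply: memv_suml => i _; apply: memvZ.
have : row i (coordmx alpha d) \in <<s>>%VS.
  by apply/sd/memv_span/map_f; rewrite mem_enum.
move/(@coord_span _ _ _ (in_tuple s)) => ->; rewrite raddf_sum /=.
apply: memv_suml => j _; rewrite map_mxZ memvZ // memv_span //.
by rewrite map_f // mem_nth.
Qed.

(** Each [alpha]-coordinate of an L-linear relation among the extended vectors is a k-linear
    relation among those of [s], hence trivial. *)
Lemma dim_ext (s : seq 'rV[k]_n) : free s -> \dim (ext s) = size s.
Proof.
move=> /(@freeP _ _ _ (in_tuple s)) fs.
pose X := map_tuple (map_mx (in_alg L)) (in_tuple s).
rewrite -[RHS](size_map (map_mx (in_alg L))); apply/eqP.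
rewrite -[_ == _]/(free X); apply/freeP => c c0 j.
rewrite [c j](coord_basis basis_alpha (memvf _)) big1 // => i _.
rewrite (fs (fun j => coord alpha i (c j))) ?scale0r //.
rewrite -row_coordmx_sum; apply: etrans (_ : row i (coordmx alpha 0) = 0).
  by congr (row i (coordmx alpha _)); rewrite -[RHS]c0; apply: eq_bigr => l _;
    rewrite (nth_map 0).
by apply/rowP => l; rewrite !mxE linear0.
Qed.

Lemma RsuppD_sub (D : {vspace 'rV[L]_n}) (U : {vspace 'rV[k]_n}) :
  (RsuppD alpha D <= U)%VS <-> forall d, d \in D -> (Rsupp alpha d <= U)%VS.
Proof.
split=> [/subvP DU d dD|DU].
  apply/subvP => v vd; apply/DU/mem_spanset; exists [:: v].
  by split=> [x|]; [rewrite inE => /eqP ->; exists d|rewrite memv_span ?mem_head].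
apply/subvP => v /mem_spanset [s [sD]]; apply/subvP/span_subvP => x /sD [d dD].
exact/subvP/DU.
Qed.

Lemma sub_ext (D : {vspace 'rV[L]_n}) (s : seq 'rV[k]_n) :
  (D <= ext s)%VS <-> (RsuppD alpha D <= <<s>>)%VS.
Proof.
rewrite RsuppD_sub; split=> [/subvP Ds d /Ds|Ds]; first by rewrite mem_ext.
by apply/subvP => d /Ds; rewrite mem_ext.
Qed.

(** By [sub_ext], an extended space contains [D] exactly when the k-space it comes from contains the
    rank support of [D]. *)
Lemma starE (D : {vspace 'rV[L]_n}) : star D = ext (vbasis (RsuppD alpha D)).
Proof.
apply/eqP; rewrite eqEsubv; apply/andP; split; apply/subvP => v.
  move=> /mem_capset; apply; split; first by exists (vbasis (RsuppD alpha D)).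
  by apply/sub_ext; rewrite (span_basis (vbasisP _)).
rewrite mem_ext (span_basis (vbasisP _)) // => vD; apply/mem_capset => _ [[s ->]].
by rewrite mem_ext => /sub_ext; apply: subv_trans.
Qed.

Lemma dim_star (D : {vspace 'rV[L]_n}) : \dim (star D) = wtRD alpha D.
Proof.
by rewrite starE dim_ext ?(basis_free (vbasisP _)) // size_tuple.
Qed.

Lemma star_id (D : {vspace 'rV[L]_n}) : star (star D) = star D.
Proof.
apply/eqP; rewrite eqEsubv; apply/andP; split; apply/subvP => v.
  move/mem_capset; apply; split=> //.
  by rewrite starE; exists (vbasis (RsuppD alpha D)).
move=> vD; apply/mem_capset => V [_ /subvP]; exact.
Qed.

Lemma sub_star (D : {vspace 'rV[L]_n}) : (D <= star D)%VS.
Proof. by apply/subvP => v vD; apply/mem_capset => V [_ /subvP]; apply. Qed.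

Lemma wtRDS (D E : {vspace 'rV[L]_n}) :
  (D <= E)%VS -> (wtRD alpha D <= wtRD alpha E)%N.
Proof.
move=> /subvP DE; apply/dimvS/RsuppD_sub => d /DE.
exact: (RsuppD_sub E _).1 (subvv _) d.
Qed.

(** A vector [d] of maximal weight must carry the whole support of [D]: otherwise some d + t v,
    still in [D], has larger weight. *)
Lemma maxwtRE (D : {vspace 'rV[L]_n}) : (n <= m)%N ->
  maxwtR alpha D = wtRD alpha D.
Proof.
move=> nm; have [[d dD dmax] Dmax] := maxwtRP alpha D.
have dRD := (RsuppD_sub D _).1 (subvv _).
rewrite -dmax; congr (\dim _); apply/eqP; rewrite eqEsubv dRD //=.
apply/RsuppD_sub => v vD; apply: contraT => nvd; exfalso.
(* The separating vector is a column of the cokernel matrix of [coordmx alpha d]. *)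
have [a Aa Ba] : 
    exists2 a : 'cV_n, coordmx alpha d *m a = 0 & coordmx alpha v *m a != 0.
  have : ~~ (coordmx alpha v <= coordmx alpha d)%MS.
    apply: contra nvd => vd; apply/subvP => w; rewrite !mem_span_rows => wv.
    exact: submx_trans wv vd.
  rewrite submxE; set K := cokermx _ => vK.
  have [j vKj] : exists j, col j (coordmx alpha v *m K) != 0.
    apply: contrapT => all0; case/eqP: vK; apply/trmx_inj/row_matrixP => j.
    rewrite -tr_col trmx0 row0; apply: contrapT => vKj; apply: all0; exists j.
    by apply/eqP => vKj0; apply: vKj; rewrite vKj0 trmx0.
  exists (col j K); last by rewrite colE mulmxA -colE.
  by rewrite colE mulmxA mulmx_coker mul0mx.
have [t] := exists_rank_gt _ _ _ _ alpha _ _ _ basis_alpha nm Aa Ba.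
rewrite -coordmxDZ // -!dim_span_rows ltnNge => /negP; apply.
by rewrite [X in (_ <= X)%N]dmax Dmax // memvD ?memvZ.
Qed.

End Supports.

(** * Comparison of the four minima *)

Theorem theorem5p3 (k : fieldType) (L : fieldExtType k) (m : nat)
    (Hm : \dim {:L} = m)
    (alpha : m.-tuple L) (Halpha : basis_of {:L} alpha)
    (n : nat) (Hn : (1 <= n)%N) (Hnm : (n <= m)%N)
    (C : {vspace 'rV[L]_n}) (r : nat) (Hr : (1 <= r <= \dim C)%N) :
  [/\ dR alpha r C = Mr r C, Mr r C = OS alpha r C & OS alpha r C = Dr alpha r C].
Proof.
have mE (D : {vspace 'rV[L]_n}) : maxwtR alpha D = wtRD alpha D.
  exact: maxwtRE.
have msE (D : {vspace 'rV[L]_n}) : maxwtR alpha (star D) = wtRD alpha D.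
  by rewrite mE -!(dim_star alpha Halpha) (star_id alpha Halpha).
have -> : OS alpha r C = dR alpha r C by rewrite /OS (funext mE).
have -> : Dr alpha r C = dR alpha r C by rewrite /Dr (funext msE).
suff -> : dR alpha r C = Mr r C by [].
case/andP: Hr => _ rC; have [D DC] := exists_subspace rC.
have [V VC] := Mr_nonempty rC.
rewrite /dR /Mr; set SD := (X in natmin X = _); set SV := (X in _ = natmin X).
have /natminP [[D0 [D0C D0r] <-] Dmin] : exists d, SD d.
  by exists (wtRD alpha D), D.
have /natminP [[V0 [V0s V0r] <-] Vmin] : exists d, SV d by exists (\dim V), V.
apply/eqP; rewrite eqn_leq; apply/andP; split.
  (* An r-dimensional [E] inside the intersection of [C] with an optimal [V0] has weight at most
     that of [V0], which is \dim V0 because [V0] is its own star. *)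
  have [E [EV Er]] := exists_subspace V0r.
  apply: leq_trans (Dmin (wtRD alpha E) _) _.
    by exists E => //; split=> //; apply: subv_trans EV (capvSl _ _).
  rewrite V0s (dim_star alpha Halpha).
  by apply/wtRDS/(subv_trans EV)/capvSr.
(* Conversely, the star of an optimal [D0] is admissible for [Mr], since it meets [C] in at least
   [D0]. *)
rewrite -(dim_star alpha Halpha); apply: Vmin; exists (star D0) => //.
split; first by rewrite (star_id alpha Halpha).
by rewrite -D0r; apply/dimvS; rewrite subv_cap D0C sub_star.
Qed.
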